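(* Let $k$ and $s$ be positive integers. If a finite simple graph $G$ contains $s$ (distinct) cycles of length $2k+1$, then \[\operatorname{sum}(G)\geq\sqrt[2k+1]{(4k+2)s}+1.\]
   Context: For a finite simple graph $G$ and an injective labelling $f:V(G)\to\mathbb{Z}$, define $f_+(uv)=f(u)+f(v)$ for $uv\in E(G)$. The sum index $\operatorname{sum}(G)$ is the minimum, over all injective $f:V(G)\to\mathbb{Z}$, of the number of distinct values taken by $f_+$ on $E(G)$. Cycles are counted as subgraphs of $G$ (not necessarily induced or disjoint; different starting points or directions do not give different cycles). *)

(* Defs.v *)
From HB Require Import structures.
From mathcomp Require Import all_boot all_order all_algebra.
From mathcomp Require Import boolp reals exp.

Set Implicit Arguments.
Unset Strict Implicit.
Unset Printing Implicit Defensive.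

Import Order.TTheory GRing.Theory Num.Theory.

Record sgraph := SGraph {
  vertex :> finType;
  adj : rel vertex;
  adj_sym : symmetric adj;
  adj_irrefl : irreflexive adj
}.

Definition edge_sums (G : sgraph) (f : G -> int) : seq int :=
  undup [seq (f uv.1 + f uv.2)%R | uv in [pred uv : G * G | adj uv.1 uv.2]].

Definition attains_sums (G : sgraph) (m : nat) : Prop :=
  exists2 f : G -> int, injective f & size (edge_sums f) = m.

Lemma attains_sums_ex (G : sgraph) : exists m, `[< attains_sums G m >].
Proof.
pose f (v : G) : int := Posz (enum_rank v).
exists (size (edge_sums f)); apply/asboolP; exists f => // u v [] /ord_inj.
exact: enum_rank_inj.
Qed.

Definition sum_index (G : sgraph) : nat := ex_minn (attains_sums_ex G).

(* A subgraph is given by its vertex set and its edge set, an edge being the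
   set of its two ends; [cycle_subgraph c] forgets the starting point and the
   direction in which [c] is listed. *)
Definition cycle_subgraph (G : sgraph) (c : seq G) : {set G} * {set {set G}} :=
  ([set x in c], [set [set x; next c x] | x in c]).

(* The bound 3 <= n matters: a pair of adjacent vertices, traversed back and
   forth, satisfies [ucycle]. *)
Definition cycles (G : sgraph) (n : nat) : {set {set G} * {set {set G}}} :=
  [set cycle_subgraph c | c : n.-tuple G & (3 <= n) && ucycleb (@adj G) c].

(* Main.v *)
Require Import Defs.
From mathcomp Require Import all_boot all_order all_algebra.
From mathcomp Require Import boolp reals exp.
From mathcomp Require Import zify ring.

Import Order.TTheory GRing.Theory Num.Theory.

(** Fix an optimal labelling [f], let [m] be the number of its edge sums, and
    list a cycle of odd length [n] from a chosen vertex in a chosen direction.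
    The cyclic word of the [n] edge sums determines the listing: [n] being odd,
    the alternating sum of the word is twice the label of the first vertex.
    Two consecutive letters differ because [f] is injective and the two
    vertices at distance 2 are distinct.  Hence there are no more listings than
    closed walks of length [n] in the complete graph on [m] vertices, namely
    [(m - 1) ^ n - (m - 1)].  Each cycle has [2 n] listings, so
    [2 n s <= (m - 1) ^ n]. *)

(** * Closed walks in a complete graph *)

Section ClosedWalks.

Context {T : eqType}.
Variable S : seq T.

(* A walk is listed without its first vertex [x], so a closed walk is listed
   as a cyclic word. *)
Fixpoint walks (n : nat) (x y : T) : seq (seq T) :=
  if n is n'.+1 then
    flatten [seq [seq z :: p | p <- walks n' z y] | z <- S & z != x]
  else if x == y then [:: [::]] else [::].

Lemma mem_walks (x y : T) (p : seq T) :
    {subset p <= S} -> path (fun a b => a != b) x p -> last x p = y ->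
  p \in walks (size p) x y.
Proof.
elim: p x => [|z p IHp] x /= sub_pS; first by move=> _ ->; rewrite eqxx inE.
move=> /andP[neq_xz path_p] last_p; apply/flatten_mapP; exists z.
  by rewrite mem_filter eq_sym neq_xz sub_pS ?mem_head.
by apply: map_f; apply: IHp => // t tp; rewrite sub_pS // inE tp orbT.
Qed.

Lemma size_walksS (n : nat) (x y : T) :
  size (walks n.+1 x y) = (\sum_(z <- S | z != x) size (walks n z y))%N.
Proof.
rewrite /= size_flatten /shape -map_comp sumnE big_map big_filter.
by apply: eq_bigr => z _ /=; rewrite size_map.
Qed.

Hypothesis uniq_S : uniq S.

(* The adjacency matrix of the complete graph on [m] vertices has eigenvalue
   [m - 1] on constant vectors and [-1] on their orthogonal complement. *)
Lemma size_walks (n : nat) (x y : T) : x \in S -> y \in S ->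
  ((size S)%:R * (size (walks n x y))%:R
   = ((size S)%:R - 1) ^+ n + (-1) ^+ n * ((size S)%:R * (x == y)%:R - 1)
   :> int)%R.
Proof.
move=> xS yS; elim: n x xS => [|n IHn] x xS.
  by rewrite /= !expr0; case: eqP => _ /=; ring.
rewrite size_walksS natr_sum mulr_sumr.
(* Summed over all [z], the multiples of [(-1) ^+ n] cancel: the indicator contributes [size S]
   once, the constant [-1] once per letter. Removing the term [z = x] then gives the count for
   [n.+1]. *)
have total : (\sum_(z <- S) (size S)%:R * (size (walks n z y))%:R
    = (size S)%:R * ((size S)%:R - 1) ^+ n :> int)%R.
  rewrite (eq_big_seq _ (fun z => IHn z)) big_split /= -mulr_sumr big_split /=.
  have delta : (\sum_(z <- S) (z == y)%:R = 1 :> int)%R.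
    by rewrite (bigD1_seq y) //= eqxx big1 => [|z /negbTE->]; rewrite ?addr0.
  rewrite -mulr_sumr delta.
  rewrite !big_const_seq !count_predT !iter_addr_0.
  by rewrite -mulr_natr -[X in (_ * (_ + X))%R]mulr_natr; ring.
have := total; rewrite (bigD1_seq x) //= IHn // => /(canRL (addKr _)) ->.
by rewrite !exprS; case: eqP => _ /=; ring.
Qed.

Lemma size_closed_walks (n : nat) : odd n ->
  (size (flatten [seq walks n x x | x <- S]) <= (size S).-1 ^ n)%N.
Proof.
move=> odd_n; have [S0|S_gt0] := posnP (size S).
  by rewrite (size0nil S0).
(* Scaling by [size S] allows a comparison for each base point [x] separately; as [n] is odd, the
   correction term there is [1 - size S], which is at most 0. *)
rewrite -(leq_pmul2l S_gt0) size_flatten /shape -map_comp sumnE big_map.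
rewrite big_distrr /= -[X in (_ <= X * _)%N]sum1_size big_distrl /= !big_seq.
apply: leq_sum => x xS; rewrite mul1n.
have := size_walks n x x xS xS.
rewrite -signr_odd odd_n eqxx expr1 mulr1 -natrM.
have -> : ((size S)%:R - 1 = (size S).-1%:R :> int)%R.
  by rewrite -subn1 natrB.
rewrite -natrX -(ler_nat int) /= => ->.
by rewrite mulN1r gerDl oppr_le0 ler0n.
Qed.

Lemma size_cyclic_words (n : nat) (ws : seq (seq T)) : odd n -> uniq ws ->
    {in ws, forall w, [/\ size w = n, {subset w <= S}
                        & cycle (fun a b => a != b) w]} ->
  (size ws <= (size S).-1 ^ n)%N.
Proof.
move=> odd_n uniq_ws wsP.
apply: leq_trans (size_closed_walks n odd_n).
(* Rotating by one puts the first letter [a] last, which makes the word a walk from [a] to [a]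
   listed without its start. *)
rewrite -(size_map (rot 1)); apply: uniq_leq_size.
  by rewrite map_inj_uniq //; exact: rot_inj.
move=> _ /mapP[w /wsP[size_w wS cyc_w] ->].
case: w => [|a w] in size_w wS cyc_w *; first by rewrite -size_w in odd_n.
rewrite rot1_cons; apply/flatten_mapP; exists a; first exact/wS/mem_head.
rewrite -size_w -[size _](size_rcons w a); apply: mem_walks => //.
  by move=> z; rewrite mem_rcons; exact: wS.
by rewrite last_rcons.
Qed.

End ClosedWalks.

(** * Successors in cyclic lists without repetition *)

Section Next.

Context {T : eqType}.
Implicit Types (x : T) (c : seq T).

Lemma next_next_neq c x : uniq c -> (2 < size c)%N -> x \in c ->
  next c (next c x) != x.
Proof.
move=> uniq_c size_c xc; have [i p def_c] := rot_to xc.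
rewrite -!(next_rot i uniq_c).
have : uniq (rot i c) by rewrite rot_uniq.
have : (2 < size (rot i c))%N by rewrite size_rot.
rewrite def_c; case: p {def_c} => [|y [|z p]] //= _.
rewrite !inE !negb_or -!andbA => /and5P[xy xz _ yz _].
by rewrite eqxx [y == x]eq_sym (negbTE xy) eqxx eq_sym.
Qed.

Lemma map_next_pairmap {U : Type} (h : T -> T -> U) x p : uniq (x :: p) ->
  [seq h y (next (x :: p) y) | y <- x :: p] = pairmap h x (rcons p x).
Proof.
move=> uniq_c; apply: (@eq_from_nth _ (h x x)).
  by rewrite size_map size_pairmap size_rcons.
rewrite size_map => i lt_i.
rewrite (nth_map x) // (nth_pairmap x) ?size_rcons //.
rewrite next_nth mem_nth // index_uniq //.
rewrite -rcons_cons !nth_rcons lt_i; congr h.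
(* At the last position [next] reads past the end of [p]; the default value [x] closes the cycle. *)
by case: ltnP => // le_p_i; rewrite if_same nth_default.
Qed.

Lemma rot_inj_uniq c (i j : nat) : uniq c -> (i < size c)%N ->
  (j < size c)%N -> rot i c = rot j c -> i = j.
Proof.
case: c => // x c uniq_c lt_i lt_j eq_rot.
have /eqP : nth x (rot i (x :: c)) 0 = nth x (rot j (x :: c)) 0.
  by rewrite eq_rot.
rewrite /rot !nth_cat !size_drop !subn_gt0 lt_i lt_j !nth_drop !addn0.
by rewrite nth_uniq // => /eqP.
Qed.

End Next.

(** * Recovering a listing from its word of edge sums *)

Section EdgeSums.

Context {T : eqType} {V : zmodType}.
Variable f : T -> V.

(** Equal edge sums force the difference of the two current labels to change sign at each step. *)
Lemma last_pairmap_add (x y : T) (p q : seq T) :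
    pairmap (fun a b => f a + f b)%R x p
      = pairmap (fun a b => f a + f b)%R y q ->
  (f (last x p) - f (last y q) = (f x - f y) *~ (-1) ^+ size p)%R.
Proof.
elim: p q x y => [|a p IHp] [|b q] x y //= [eq_sum /IHp->].
rewrite exprS mulN1r mulrNz -mulNrz; congr (_ *~ _)%R.
by rewrite opprB -[f a](addKr (f x)) eq_sum addrA addrK addrC.
Qed.

Hypothesis inj_f : injective f.

Lemma pairmap_add_inj (x : T) :
  injective (pairmap (fun a b => f a + f b)%R x).
Proof.
move=> p q; elim: p q x => [|a p IHp] [|b q] x //= [/addrI/inj_f<-].
by move=> /IHp<-.
Qed.

End EdgeSums.

Definition sum_word {T : eqType} (f : T -> int) (c : seq T) : seq int :=
  [seq (f x + f (next c x))%R | x <- c].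

Lemma sum_word_inj {T : eqType} (f : T -> int) (c d : seq T) :
    injective f -> uniq c -> uniq d -> odd (size c) ->
  sum_word f c = sum_word f d -> c = d.
Proof.
move=> inj_f uniq_c uniq_d odd_c eq_w.
have := congr1 size eq_w; rewrite !size_map.
case: c => // x p in uniq_c odd_c eq_w *.
case: d => // y q in uniq_d eq_w * => _.
move: eq_w; rewrite /sum_word.
rewrite (map_next_pairmap (fun a b => f a + f b)%R) //.
rewrite (map_next_pairmap (fun a b => f a + f b)%R) // => eq_w.
(* Both walks are back at their starts after an odd number of steps, so [f x - f y] is its own
   negative. *)
have := last_pairmap_add f _ _ _ _ eq_w; rewrite !last_rcons size_rcons.
rewrite -signr_odd odd_c expr1 => e.
have /inj_f exy : f x = f y by lia.
by move: eq_w; rewrite -exy => /(pairmap_add_inj f inj_f)/rcons_inj[<-].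
Qed.

(** * The listings of a cycle and their words *)

Section Listings.

Variable G : sgraph.
Implicit Types c : seq G.

Lemma cycle_subgraph_rot (i : nat) c : uniq c ->
  cycle_subgraph (rot i c) = cycle_subgraph c.
Proof.
move=> uniq_c; congr pair; first by apply/setP=> x; rewrite !inE mem_rot.
apply/setP=> e; apply/imsetP/imsetP => [] [x xc ->]; exists x;
  by rewrite ?next_rot ?mem_rot // -(mem_rot i).
Qed.

Lemma cycle_subgraph_rev c : uniq c ->
  cycle_subgraph (rev c) = cycle_subgraph c.
Proof.
move=> uniq_c; congr pair; first by apply/setP=> x; rewrite !inE mem_rev.
apply/setP=> e; apply/imsetP/imsetP => [] [x xc ->].
  exists (prev c x); first by rewrite mem_prev -mem_rev.
  by rewrite next_rev // next_prev // setUC.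
exists (next c x); first by rewrite mem_rev mem_next.
by rewrite next_rev // prev_next // setUC.
Qed.

Lemma ucycle_rev c : ucycleb (@adj G) (rev c) = ucycleb (@adj G) c.
Proof.
rewrite /ucycleb rev_uniq rev_cycle; congr (_ && _).
by apply: eq_cycle => x y; rewrite adj_sym.
Qed.

Definition listings c : seq (seq G) :=
  [seq rot i c | i <- iota 0 (size c)]
    ++ [seq rot i (rev c) | i <- iota 0 (size c)].

Lemma size_listings c : size (listings c) = (2 * size c)%N.
Proof. by rewrite size_cat !size_map size_iota mul2n addnn. Qed.

Lemma uniq_rots c : uniq c -> uniq [seq rot i c | i <- iota 0 (size c)].
Proof.
move=> uniq_c; rewrite map_inj_in_uniq ?iota_uniq // => i j.
by rewrite !mem_iota; apply: rot_inj_uniq.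
Qed.

(** If a rotation of [c] were a rotation of [rev c], successors and predecessors in [c] would agree,
    contradicting [next_next_neq]. *)
Lemma uniq_listings c : uniq c -> (2 < size c)%N -> uniq (listings c).
Proof.
move=> uniq_c size_c.
have := uniq_rots (rev c); rewrite rev_uniq size_rev => /(_ uniq_c) uniq_rev.
rewrite cat_uniq uniq_rots // uniq_rev andbT.
apply/hasPn => _ /mapP[j _ ->]; apply/mapP => -[i _ eq_rot].
case: c => // x c in uniq_c size_c uniq_rev eq_rot *.
have /negP[] := next_next_neq _ x uniq_c size_c (mem_head x c).
rewrite -(next_rot i uniq_c) -eq_rot next_rot ?rev_uniq //.
by rewrite next_rev // prev_next.
Qed.

Lemma listingsP c d : ucycleb (@adj G) c -> d \in listings c ->
  [/\ size d = size c, ucycleb (@adj G) d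
    & cycle_subgraph d = cycle_subgraph c].
Proof.
move=> cyc_c; have uniq_c := ucycle_uniq cyc_c.
rewrite mem_cat => /orP[] /mapP[i _ ->]; rewrite size_rot.
  by rewrite /ucycleb rot_cycle rot_uniq cycle_subgraph_rot.
rewrite size_rev cycle_subgraph_rot ?rev_uniq // cycle_subgraph_rev //.
by split=> //; rewrite /ucycleb rot_cycle rot_uniq -/(ucycleb _ _) ucycle_rev.
Qed.

Lemma card_cycles_listings (n : nat) : (2 < n)%N ->
  (2 * n * #|cycles G n| <= #|[set c : n.-tuple G | ucycleb (@adj G) c]|)%N.
Proof.
move=> n_gt2; rewrite /cycles n_gt2 /=.
rewrite -[X in (_ <= X)%N]sum1_card.
(* Tuples are grouped by the cycle they list; each fibre contains the [2 * n] listings of any one of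
   its members. *)
rewrite (partition_big_imset (fun c : n.-tuple G => cycle_subgraph c)) /=.
rewrite mulnC -sum_nat_const; apply: leq_sum => _ /imsetP[c cA ->].
rewrite inE in cA; have uniq_c := ucycle_uniq cA.
rewrite sum1dep_card -[in leqLHS](size_tuple c) -size_listings.
rewrite cardE -(size_map val); apply: uniq_leq_size.
  by apply: uniq_listings; rewrite ?size_tuple.
move=> d /(listingsP _ _ cA)[/eqP size_d cyc_d sub_d].
rewrite size_tuple in size_d.
apply/mapP; exists (Tuple size_d) => //.
by rewrite mem_enum !inE sub_d eqxx andbT.
Qed.

Lemma sum_word_edge_sums (f : G -> int) c : ucycleb (@adj G) c ->
  {subset sum_word f c <= edge_sums f}.
Proof.
move=> /ucycle_cycle cyc_c _ /mapP[x xc ->]; rewrite mem_undup.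
apply/imageP; exists (x, next c x) => //=.
by rewrite inE; apply: next_cycle.
Qed.

Lemma cycle_sum_word (f : G -> int) c : injective f -> uniq c ->
  (2 < size c)%N -> cycle (fun a b => a != b) (sum_word f c).
Proof.
move=> inj_f uniq_c size_c.
apply: (homo_cycle_in (P := mem c) _ _ (cycle_next uniq_c)); last first.
  exact/allP.
move=> x y xc _ /eqP<-; rewrite addrC (inj_eq (addrI _)) (inj_eq inj_f).
by rewrite eq_sym next_next_neq.
Qed.

Lemma card_listings_edge_sums (f : G -> int) (n : nat) :
    injective f -> odd n -> (2 < n)%N ->
  (#|[set c : n.-tuple G | ucycleb (@adj G) c]|
     <= (size (edge_sums f)).-1 ^ n)%N.
Proof.
move=> inj_f odd_n n_gt2; rewrite cardE.
rewrite -(size_map (fun c : n.-tuple G => sum_word f c)).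
apply: size_cyclic_words => //; first exact: undup_uniq.
  rewrite map_inj_in_uniq ?enum_uniq // => c d.
  rewrite !mem_enum !inE => cyc_c cyc_d.
  move=> /(sum_word_inj _ _ _ inj_f)/val_inj->//.
  - exact: ucycle_uniq cyc_c.
  - exact: ucycle_uniq cyc_d.
  - by rewrite size_tuple.
move=> _ /mapP[c + ->]; rewrite mem_enum inE => cyc_c.
rewrite size_map size_tuple; split=> //; first exact: sum_word_edge_sums.
by apply: cycle_sum_word; rewrite ?(ucycle_uniq cyc_c) ?size_tuple.
Qed.

End Listings.

(** * The bound on the sum index *)

Lemma sum_index_attained (G : sgraph) : attains_sums G (sum_index G).
Proof. by rewrite /sum_index; case: ex_minnP => m /asboolP. Qed.

Theorem theorem2p1 (R : realType) (k s : nat) (G : sgraph)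
    (k_gt0 : (0 < k)%N) (s_gt0 : (0 < s)%N)
    (G_cycles : (s <= #|cycles G (2 * k + 1)|)%N) :
  ((((4 * k + 2) * s)%N%:R : R) `^ ((2 * k + 1)%N%:R^-1) + 1
     <= (sum_index G)%:R)%R.
Proof.
have [f inj_f <-] := sum_index_attained G.
set m := size (edge_sums f); set n := (2 * k + 1)%N in G_cycles *.
have odd_n : odd n by rewrite /n; lia.
have n_gt2 : (2 < n)%N by rewrite /n; lia.
have bound : ((4 * k + 2) * s <= m.-1 ^ n)%N.
  apply: leq_trans (card_listings_edge_sums _ f n inj_f odd_n n_gt2).
  apply: leq_trans (card_cycles_listings _ n n_gt2).
  by apply: leq_mul => //; rewrite /n; lia.
(* For [m = 0] the truncated [m.-1] is 0 and [bound] fails, its left side being positive; hence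
   [m.-1] is the true [m - 1]. *)
have m_gt0 : (0 < m)%N.
  case: (posnP m) bound => // ->; rewrite exp0n; lia.
rewrite -lerBrDr -(natrB _ m_gt0) subn1.
have -> : (m.-1%:R = ((m.-1 ^ n)%N%:R : R) `^ n%:R^-1)%R.
  rewrite natrX -powR_mulrn // -powRrM mulfV ?powRr1 //.
  by rewrite pnatr_eq0; lia.
by rewrite ge0_ler_powR ?nnegrE ?invr_ge0 ?ler_nat.
Qed.
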